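(* Let $\xi<\omega_1$. There is no Borel set $S\subseteq 2^\omega\times 2^\omega$ with the following property: for any Polish spaces $X,Y$ and any disjoint analytic subsets $A,B$ of $X\times Y$, exactly one of the following holds: (a) There is a $\mathrm{pot}(\mathbf{\Pi}^0_{1+\xi})$ set $D\subseteq X\times Y$ with $A\subseteq D$ and $D\cap B=\emptyset$. (b) There are continuous maps $u:2^\omega\to X$ and $v:2^\omega\to Y$ with $S\subseteq (u\times v)^{-1}(A)$ and $(2^\omega\times 2^\omega)\setminus S\subseteq (u\times v)^{-1}(B)$.
   Context: A Borel set $A\subseteq X\times Y$ ($X,Y$ Polish) is $\mathrm{pot}(\Gamma)$ if there are Polish topologies $\sigma$ on $X$ and $\tau$ on $Y$, finer than the original ones, with $A\in\Gamma([X,\sigma]\times[Y,\tau])$. *)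

(* Defs.v *)
From HB Require Import structures.
From mathcomp Require Import all_boot all_order all_algebra.
From mathcomp Require Import all_classical all_reals.
From mathcomp Require Import topology cantor measure.
From Stdlib Require Import Rdefinitions.

Set Implicit Arguments.
Unset Strict Implicit.
Unset Printing Implicit Defensive.

Local Open Scope classical_set_scope.

Definition polish_top (X : Type) (O : set (set X)) : Prop :=
  (exists d : X -> X -> R,
     (forall x y, d x y = 0%R <-> x = y) /\
     (forall x y, d x y = d y x) /\
     (forall x y z, Rle (d x z) (Rplus (d x y) (d y z))) /\
     (forall U, O U <-> (forall x, U x -> exists e, Rlt 0%R e /\
                           (forall y, Rlt (d x y) e -> U y))) /\
     (forall u : nat -> X,
        (forall e, Rlt 0%R e -> exists N, forall m n, (N <= m)%N -> (N <= n)%N ->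
              Rlt (d (u m) (u n)) e) ->
        exists x, forall e, Rlt 0%R e -> exists N, forall n, (N <= n)%N ->
              Rlt (d (u n) x) e)) /\
  (exists D : set X, countable D /\
     forall U, O U -> U !=set0 -> (D `&` U) !=set0).

Definition polish (X : topologicalType) : Prop := polish_top (@open X).

Definition prod_top (X Y : Type) (O1 : set (set X)) (O2 : set (set Y))
  : set (set (X * Y)) :=
  fun W => forall p, W p -> exists U V, [/\ O1 U, O2 V, U p.1, V p.2 &
                                  (forall q : X * Y, U q.1 -> V q.2 -> W q)].

(* Additive Borel classes. Countable ordinals are represented by elements
   of a countable well-ordered set (I, Rel): for i : I, let xi_i be the order
   type of the set of Rel-predecessors of i.  Then
   [sigmaB O Rel i] = Sigma^0_{1+xi_i}  and  [piB O Rel i] = Pi^0_{1+xi_i}: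
     Sigma^0_{1+xi} = open sets, together with countable unions of sets
     lying in Pi^0_{1+eta} for some eta < xi. *)
Inductive sigmaB (X : Type) (O : set (set X)) (I : Type) (Rel : I -> I -> Prop)
  : I -> set X -> Prop :=
| sigmaB_open i A : O A -> sigmaB O Rel i A
| sigmaB_union i (j : nat -> I) (A : nat -> set X) :
    (forall n, Rel (j n) i) ->
    (forall n, sigmaB O Rel (j n) (~` A n)) ->
    sigmaB O Rel i (\bigcup_n A n).

Definition piB (X : Type) (O : set (set X)) (I : Type) (Rel : I -> I -> Prop)
  (i : I) (D : set X) : Prop := sigmaB O Rel i (~` D).

Definition strict_well_order (I : Type) (Rel : I -> I -> Prop) : Prop :=
  [/\ (forall x, ~ Rel x x),
      (forall x y z, Rel x y -> Rel y z -> Rel x z),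
      (forall x y, x <> y -> Rel x y \/ Rel y x) &
      well_founded Rel].

Definition pot_piB (X Y : topologicalType) (I : Type) (Rel : I -> I -> Prop)
  (i : I) (D : set (X * Y)) : Prop :=
  exists (sigma : set (set X)) (tau : set (set Y)),
    [/\ (forall U, open U -> sigma U), polish_top sigma,
        (forall V, open V -> tau V), polish_top tau &
        piB (prod_top sigma tau) Rel i D].

Definition analytic (T : topologicalType) (A : set T) : Prop :=
  exists (Z : topologicalType) (f : Z -> T),
    [/\ polish Z, continuous f & f @` setT = A].

Definition borel (T : topologicalType) (A : set T) : Prop :=
  smallest (sigma_algebra setT) (@open T) A.

(* Main.v *)
(* Let [C] be a subset of the Baire space whose complement is not Sigma^0_{1+xi}
   (the diagonal of a universal set), and let [z |-> sidon z] be a continuous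
   injection of the Baire space into Z^omega whose range is a Sidon set.  Put
   [A = {(x, x - sidon z) | z in C}] and [B = {(x, x - sidon z) | z notin C}].

   A pot(Pi^0_{1+xi}) set [D] separating [A] from [B] cannot exist: open sets of
   finer Polish topologies have the Baire property, so the category transform
   [{z | (x, x - sidon z) notin D for non-meagerly many x}] is Sigma^0_{1+xi} by
   induction along the hierarchy, yet it equals the complement of [C].

   Hence (b) provides [u] and [v].  All of [u(2^omega) x v(2^omega)] lies in the union
   of [A] and [B], which contains no 2 x 2 rectangle by the Sidon property, so [u] or
   [v] is constant and [S] is the preimage of [C] by a continuous function of one
   coordinate.  Then (a) and (b) both hold for the pair of a cylinder over [C] and
   the cylinder over its complement, because a finer Polish topology makes [C] clopen. *)
Require Import Defs.
From Stdlib Require Import Reals Lra.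
From HB Require Import structures.
From mathcomp Require Import all_boot all_order all_algebra.
From mathcomp Require Import all_classical all_reals.
From mathcomp Require Import topology cantor measure.
From mathcomp Require Import zify.

Import GRing.Theory.

Set Implicit Arguments.
Unset Strict Implicit.
Unset Printing Implicit Defensive.

Local Open Scope classical_set_scope.

(** * Polish spaces coded by sequences of natural numbers *)

Definition agree (T : Type) (Phi : T -> nat -> nat) (n : nat) (x y : T) : Prop :=
  forall m, (m < n)%N -> Phi x m = Phi y m.

(** The topology pulled back along [Phi] from the Baire space. *)
Definition copen (T : Type) (Phi : T -> nat -> nat) : set (set T) :=
  fun U => forall x, U x -> exists n, forall y, agree Phi n x y -> U y.

Definition closed_range (T : Type) (Phi : T -> nat -> nat) : Prop :=
  forall q, (forall n, exists x, forall m, (m < n)%N -> Phi x m = q m) ->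
  exists x, forall m, Phi x m = q m.

Lemma agree_le (T : Type) (Phi : T -> nat -> nat) (n m : nat) (x y : T) :
  (m <= n)%N -> agree Phi n x y -> agree Phi m x y.
Proof. by move=> mn h k km; apply: h; apply: leq_trans mn. Qed.

Lemma agree_sym (T : Type) (Phi : T -> nat -> nat) (n : nat) (x y : T) :
  agree Phi n x y -> agree Phi n y x.
Proof. by move=> h k /h. Qed.

(** An alias recording [Phi], so that different codes can put different topologies on one set. *)
Definition coded (T : Type) (Phi : T -> nat -> nat) : Type := T.

HB.instance Definition _ (T : Type) (Phi : T -> nat -> nat) :=
  gen_eqMixin (coded Phi).
HB.instance Definition _ (T : Type) (Phi : T -> nat -> nat) :=
  gen_choiceMixin (coded Phi).

Lemma copenT (T : Type) (Phi : T -> nat -> nat) : copen Phi setT.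
Proof. by move=> x _; exists 0. Qed.

Lemma copenI (T : Type) (Phi : T -> nat -> nat) : setI_closed (copen Phi).
Proof.
move=> U V oU oV x [/oU[n Un] /oV[m Vm]]; exists (maxn n m) => y h.
by split; [apply: Un|apply: Vm]; apply: agree_le h; lia.
Qed.

Lemma copen_bigcup (T : Type) (Phi : T -> nat -> nat) (I : Type)
  (f : I -> set T) : (forall i, copen Phi (f i)) -> copen Phi (\bigcup_i f i).
Proof. by move=> h x [i _ /h[n fn]]; exists n => y /fn fy; exists i. Qed.

HB.instance Definition _ (T : Type) (Phi : T -> nat -> nat) :=
  isOpenTopological.Build (coded Phi) (@copenT T Phi) (@copenI T Phi)
    (@copen_bigcup T Phi).

Lemma open_coded (T : Type) (Phi : T -> nat -> nat) :
  (@open (coded Phi)) = copen Phi.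
Proof. by []. Qed.

Lemma coded_continuous (T T' : Type) (Phi : T -> nat -> nat)
  (Phi' : T' -> nat -> nat) (f : coded Phi -> coded Phi') :
  (forall x n, exists m, forall y, agree Phi m x y -> agree Phi' n (f x) (f y)) ->
  continuous f.
Proof.
move=> h; apply/continuousP => A; rewrite !open_coded => oA x /oA [n An].
by have [m hm] := h x n; exists m => y /hm; apply: An.
Qed.

Definition eps (n : nat) : R := Rinv (INR n.+1).

Lemma eps_gt0 n : Rlt 0 (eps n).
Proof. by apply: Rinv_0_lt_compat; apply: lt_0_INR; lia. Qed.

Lemma eps_le m n : (m <= n)%N -> Rle (eps n) (eps m).
Proof.
move=> mn; apply: Rinv_le_contravar; first by apply: lt_0_INR; lia.
by apply: le_INR; lia.
Qed.

Lemma eps_small e : Rlt 0 e -> exists n, Rlt (eps n) e.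
Proof.
move=> /archimed_cor1 [[|n] [h n0]]; first lia.
by exists n.
Qed.

Definition cdist (T : Type) (Phi : T -> nat -> nat) (x y : T) : R :=
  match pselect (exists n, Phi x n != Phi y n) with
  | left h => eps (ex_minn h)
  | right _ => IZR 0
  end.

Lemma cdist_ge0 (T : Type) (Phi : T -> nat -> nat) x y : Rle 0 (cdist Phi x y).
Proof.
rewrite /cdist; case: pselect => [h|_]; last exact: Rle_refl.
exact/Rlt_le/eps_gt0.
Qed.

Lemma cdist_le (T : Type) (Phi : T -> nat -> nat) n x y :
  agree Phi n x y -> Rle (cdist Phi x y) (eps n).
Proof.
move=> a; rewrite /cdist; case: pselect => [h|_]; last exact/Rlt_le/eps_gt0.
case: ex_minnP => m nem _; apply: eps_le; rewrite leqNgt; apply/negP => /a e.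
by rewrite e eqxx in nem.
Qed.

Lemma cdist_ge (T : Type) (Phi : T -> nat -> nat) n x y :
  Phi x n <> Phi y n -> Rle (eps n) (cdist Phi x y).
Proof.
move=> /eqP ne; rewrite /cdist; case: pselect => [h|[]]; last by exists n.
by case: ex_minnP => m _ /(_ _ ne) mn; apply: eps_le.
Qed.

Lemma cdist_lt (T : Type) (Phi : T -> nat -> nat) n x y :
  Rlt (cdist Phi x y) (eps n) -> agree Phi n x y.
Proof.
move=> lt m mn; apply: contrapT => /(@cdist_ge _ Phi).
by have := eps_le (ltnW mn); lra.
Qed.

(** Such a [Phi] identifies [T] with a closed subspace of the Baire space; [cdist] is the
    ultrametric of the first disagreement. *)
Lemma coded_polish (T : Type) (Phi : T -> nat -> nat) :
  (forall x y, Phi x =1 Phi y -> x = y) -> closed_range Phi ->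
  polish_top (copen Phi).
Proof.
move=> inj cl; split.
  exists (cdist Phi); split; [|split; [|split; [|split]]].
  - move=> x y; split=> [d0|->].
      apply: inj => n; apply: contrapT => /(@cdist_ge _ Phi).
      by rewrite d0; have := eps_gt0 n; lra.
    rewrite /cdist; case: pselect => // h; exfalso.
    by case: h => n; rewrite eqxx.
  - move=> x y; rewrite /cdist; case: pselect => [h|h]; case: pselect => [h'|h'] //.
    + congr eps; case: ex_minnP => m hm mm; case: ex_minnP => m' hm' mm'.
      by apply/eqP; rewrite eqn_leq mm ?mm' // eq_sym.
    + by case: h'; case: h => n; exists n; rewrite eq_sym.
    + by case: h; case: h' => n; exists n; rewrite eq_sym.
  - move=> x y z; rewrite {1}/cdist; case: pselect => [h|_]; last first.
      by have := cdist_ge0 Phi x y; have := cdist_ge0 Phi y z; lra.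
    case: ex_minnP => m /eqP hm _.
    have := cdist_ge0 Phi x y; have := cdist_ge0 Phi y z.
    (* [y] cannot agree with both [x] and [z] at [m], where these two differ. *)
    have [e|/(@cdist_ge _ Phi)] := pselect (Phi x m = Phi y m); last lra.
    have /(@cdist_ge _ Phi) : Phi y m <> Phi z m by rewrite -e.
    by lra.
  - move=> U; split=> oU x Ux; have := oU _ Ux.
      move=> [n Un]; exists (eps n); split; first exact: eps_gt0.
      by move=> y h; apply: Un; apply: cdist_lt.
    move=> [e [/eps_small [n ne] Ue]]; exists n => y h.
    by apply: Ue; have := cdist_le h; lra.
  - move=> u cau.
    have /choice [N hN] : forall n, exists N, forall m k, (N <= m)%N -> (N <= k)%N ->
        agree Phi n (u m) (u k).
      by move=> n; have [N hN] := cau _ (eps_gt0 n); exists N => m k Nm Nk;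
        apply: cdist_lt; apply: hN.
    have [x hx] : exists x, forall m, Phi x m = Phi (u (N m.+1)) m.
      apply: (cl (fun m => Phi (u (N m.+1)) m)) => n.
      exists (u (\max_(i < n) N i.+1)) => m mn.
      apply: (hN m.+1) => //.
      exact: (@leq_bigmax _ (fun i : 'I_n => N i.+1) (Ordinal mn)).
    exists x => e /eps_small [n ne]; exists (\max_(i < n) N i.+1) => k kn.
    apply: Rle_lt_trans ne; apply: cdist_le => m mn; rewrite hx.
    apply: (hN m.+1) => //; apply: leq_trans kn.
    exact: (@leq_bigmax _ (fun i : 'I_n => N i.+1) (Ordinal mn)).
have [[x0 _]|T0] := pselect (exists x : T, True); last first.
  by exists set0; split=> [|U _ [x]]; [exact: countable0|case: T0; exists x].
(* The dense set has one point for each finite sequence that is a prefix of a code; other sequences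
   get the default [x0]. *)
have /choice [f hf] : forall s : seq nat, exists x : T,
    (exists y, forall m, (m < size s)%N -> Phi y m = nth 0 s m) ->
    forall m, (m < size s)%N -> Phi x m = nth 0 s m.
  move=> s; have [[y hy]|h] := pselect (exists y, forall m,
    (m < size s)%N -> Phi y m = nth 0 s m); first by exists y.
  by exists x0.
exists (range f); split.
  by apply: sub_countable (card_image_le _ _) _; exact: countableP.
move=> U oU [x Ux]; have [n Un] := oU _ Ux.
exists (f [seq Phi x i | i <- iota 0 n]); split; first by eexists.
apply: Un; have nE i : (i < n)%N -> nth 0 [seq Phi x i | i <- iota 0 n] i = Phi x i.
  by move=> ni; rewrite (nth_map 0) ?size_iota // nth_iota.
move=> m mn; rewrite hf ?nE ?size_map ?size_iota //.
by exists x => i ni; rewrite nE.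
Qed.

Definition bcode (K : countType) (x : nat -> K) (n : nat) : nat := pickle (x n).

Lemma bcodeP (K : countType) n (x y : nat -> K) :
  agree (@bcode K) n x y <-> forall m, (m < n)%N -> x m = y m.
Proof.
split=> h m /h; last by rewrite /bcode => ->.
exact: (pcan_inj pickleK).
Qed.

Lemma bcode_polish (K : countType) : polish_top (copen (@bcode K)).
Proof.
apply: coded_polish => [x y h|q h].
  by apply/funext => n; apply: (pcan_inj (@pickleK K)); apply: h.
have /choice [x hx] : forall n, exists k : K, pickle k = q n.
  by move=> n; have [x hx] := h n.+1; exists (x n); apply: hx.
by exists x.
Qed.

Lemma bounded_lt (f : nat -> nat) n : exists N, forall b, (b < n)%N -> (f b < N)%N.
Proof.
exists (\max_(b < n) f b).+1 => b bn; rewrite ltnS.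
exact: (@leq_bigmax _ (fun i : 'I_n => f i) (Ordinal bn)).
Qed.

(** * Borel sets as clopen sets of finer Polish topologies *)

(* [Phi] codes a finer Polish topology on the Baire space in which [E] is clopen. *)
Definition clopenable (E : set (nat -> nat)) : Prop :=
  exists Phi : (nat -> nat) -> nat -> nat,
    [/\ closed_range Phi,
        (forall m, exists n, forall x y, agree Phi n x y -> x m = y m) &
        (exists n, forall x y, agree Phi n x y -> E x -> E y)].

Lemma clopenableC E : clopenable E -> clopenable (~` E).
Proof.
move=> [Phi [h1 h2 [n h3]]]; exists Phi; split=> //.
exists n => x y xy nx Ey; apply: nx; apply: h3 Ey; exact: agree_sym.
Qed.

Lemma clopenable_coord m (P : set nat) : clopenable (fun x => P (x m)).
Proof.
exists (fun x => x); split.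
- by move=> q _; exists q.
- by move=> k; exists k.+1 => x y; apply.
- by exists m.+1 => x y /(_ m (leqnn _)) ->.
Qed.

Definition first_index (A : nat -> set (nat -> nat)) (x : nat -> nat) (w : nat) :=
  (w = 0%N /\ forall n, ~ A n x) \/
  (exists k, [/\ w = k.+1, A k x & forall j, (j < k)%N -> ~ A j x]).

Lemma first_index_exists A x : exists w, first_index A x w.
Proof.
have [h|h] := pselect (exists n, `[< A n x >]).
  exists (ex_minn h).+1; right; case: ex_minnP => k /asboolP Ak kmin.
  by exists k; split=> // j jk /asboolP /kmin; rewrite leqNgt jk.
by exists 0%N; left; split=> // n An; apply: h; exists n; apply/asboolP.
Qed.

Lemma first_index_uniq A x w w' : first_index A x w -> first_index A x w' -> w = w'.
Proof.
move=> [[-> h]|[k [-> Ak hk]]] [[-> h']|[k' [-> Ak' hk']]] //.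
- by case: (h k').
- by case: (h' k).
- have [/hk'//|/hk//|-> //] := ltngtP k k'.
Qed.

(** Join the topologies coded by all [F n] and add the first index to the code. The points with a
    given first index form a closed set of the join, so the range stays closed, and the union
    becomes clopen. *)
Lemma clopenable_bigcup (A : nat -> set (nat -> nat)) :
  (forall n, clopenable (A n)) -> clopenable (\bigcup_n A n).
Proof.
move=> /choice [F hF].
have /choice [w wP] := first_index_exists A.
pose pos m : nat * nat := odflt (0%N, 0%N) (unpickle m).
(* Every entry carries [w x], so entry 0 already decides membership in the union. *)
pose Phi x m : nat := pickle (w x, F (pos m).1 x (pos m).2).
have /choice [lev levP] : forall a, exists n, forall x y, agree (F a) n x y -> A a x -> A a y.
  by move=> a; case: (hF a).
have posK (a b : nat) : pos (pickle (a, b)) = (a, b) by rewrite /pos pickleK.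
have PhiF a n : exists N, forall x y, agree Phi N x y -> agree (F a) n x y.
  have [N hN] := bounded_lt (fun b => pickle (a, b)) n.
  exists N => x y xy b /hN /xy; rewrite /Phi posK.
  by move=> /(pcan_inj pickleK) [].
exists Phi; split; last first.
- exists 1%N => x y /(_ 0%N erefl) /(pcan_inj pickleK) [wxy _] [n _ An].
  have [[w0 /(_ n)]//|[k [wk Ak _]]] := wP x.
  have [[w0 _]|[k' [wk' Ak' _]]] := wP y; first by lia.
  by exists k'.
- move=> m; case: (hF 0%N) => _ /(_ m) [n hn] _.
  by have [N hN] := PhiF 0%N n; exists N => x y /hN /hn.
move=> q qP.
pose dec m : nat * (nat) := odflt (0%N, 0%N) (unpickle (q m)).
have decP x m : Phi x m = q m -> dec m = (w x, F (pos m).1 x (pos m).2).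
  by move=> e; rewrite /dec -e pickleK.
pose r (a b : nat) : nat := (dec (pickle (a, b))).2.
have approx a n : exists N, forall x, (forall m, (m < N)%N -> Phi x m = q m) ->
    forall b, (b < n)%N -> F a x b = r a b.
  have [N hN] := bounded_lt (fun b => pickle (a, b)) n.
  by exists N => x xq b /hN /xq /decP; rewrite /r => ->; rewrite posK.
have /choice [z zP] : forall a, exists x, forall b, F a x b = r a b.
  move=> a; case: (hF a) => cl _ _; apply: cl => n.
  have [N hN] := approx a n; have [x hx] := qP N.
  by exists x; apply: hN.
(* The limits found in the separate codes coincide: each code determines the coordinates, and the
   approximants are common. *)
have zz a : z a = z 0%N.
  apply/funext => m.
  case: (hF a) => _ /(_ m) [n hn] _; case: (hF 0%N) => _ /(_ m) [n' hn'] _.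
  have [N hN] := approx a n; have [N' hN'] := approx 0%N n'.
  have [x hx] := qP (maxn N N').
  transitivity (x m).
    by apply: hn => b bn; rewrite zP hN // => k kN; apply: hx; lia.
  by symmetry; apply: hn' => b bn; rewrite zP hN' // => k kN; apply: hx; lia.
have {}zP a b : F a (z 0%N) b = r a b by rewrite -(zz a).
set x := z 0%N in zP; clearbody x.
have xA a : exists N, forall y, (forall m, (m < N)%N -> Phi y m = q m) ->
    (A a x <-> A a y).
  have [N hN] := approx a (lev a); exists N => y hy.
  have xy : agree (F a) (lev a) x y by move=> b bl; rewrite zP hN.
  by split; apply: levP => //; apply: agree_sym.
have wx : w x = (dec 0%N).1.
  have dec0 y : Phi y 0%N = q 0%N -> first_index A y (dec 0%N).1.
    by move=> /decP ->; apply: wP.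
  apply: (first_index_uniq (wP x)).
  (* Value [k.+1] concerns only [A 0] to [A k], so one approximant settles it; value 0 takes one
     approximant for each [a]. *)
  case E: (dec 0%N).1 dec0 => [|k] dec0; [left|right].
    split=> // a; have [N hN] := xA a; have [y hy] := qP N.+1.
    have [[_ h]|[? []//]] := dec0 y (hy 0%N (ltn0Sn _)).
    by rewrite (hN y) // => m mN; apply: hy; lia.
  have /choice [N hN] := xA.
  have [M hM] := bounded_lt N k.+1; have [y hy] := qP M.+1.
  have {}hN a : (a <= k)%N -> (A a x <-> A a y).
    by move=> ak; apply: hN => m mN; apply: hy; have := hM a; lia.
  have [[//]|[? [[<-] Ak hk]]] := dec0 y (hy 0%N (ltn0Sn _)).
  exists k; split=> //; first exact/hN.
  by move=> j jk /hN => /(_ (ltnW jk)); apply: hk.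
exists x => m; have [y hy] := qP (maxn m (pickle (pos m))).+1.
have ym : Phi y m = q m by apply: hy; lia.
(* If [m] codes no pair, [pos m] is the default and [pickle (pos m)] may differ from [m]; hence [y]
   is chosen to match [q] at both. *)
have pp : pos (pickle (pos m)) = pos m by case: (pos m) => a b; rewrite posK.
rewrite -ym /Phi wx zP /r -surjective_pairing.
by rewrite (decP y 0%N) ?(decP y (pickle (pos m))) ?pp //; apply: hy; lia.
Qed.

Lemma clopenable0 : clopenable set0.
Proof.
have -> : set0 = (fun x : nat -> nat => set0 (x 0%N)) by apply/seteqP; split=> x.
exact: clopenable_coord.
Qed.

Lemma clopenableI A B : clopenable A -> clopenable B -> clopenable (A `&` B).
Proof.
move=> cA cB; rewrite -[A `&` B]setCK setCI -bigcup2E.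
apply/clopenableC/clopenable_bigcup => -[|[|n]] /=; try exact: clopenableC.
exact: clopenable0.
Qed.

(** Plays the part of Borel measurability of [g]. *)
Definition clopenable_map (g : (nat -> nat) -> nat -> nat) : Prop :=
  forall m k, clopenable (fun z => g z m = k).

(** * Universal sets for the additive classes *)

Definition cyl (K : Type) (x : nat -> K) (n : nat) : set (nat -> K) :=
  fun y => forall m, (m < n)%N -> y m = x m.

Definition row (a : nat -> nat) (n : nat) : nat -> nat := fun m => a (pickle (n, m)).

(** The first entry of [b] is a tag and its tail a parameter. Cylinders serve the open sets, which
    are countable unions of them; complements of lower-level sets serve the union clause. *)
Definition universal_piece (I : countType) (Rel : I -> I -> Prop)
  (V : I -> (nat -> nat) -> set (nat -> nat)) (i : I) (b : nat -> nat) :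
  set (nat -> nat) :=
  match odflt (inl None) (unpickle (b 0%N)) : option (seq nat) + I with
  | inl None => set0
  | inl (Some s) => cyl (nth 0%N s) (size s)
  | inr j => if `[< Rel j i >] then ~` V j (fun m => b m.+1) else set0
  end.

Lemma clopenable_cyl s : clopenable (cyl (nth 0%N s) (size s)).
Proof.
have -> : cyl (nth 0%N s) (size s) =
    ~` (\bigcup_m (fun z : nat -> nat => (m < size s)%N && (z m != nth 0%N s m))).
  apply/seteqP; split=> z /=.
    by move=> h [m _ /andP[/h ->]]; rewrite eqxx.
  move=> h m ms; apply: contrapT => /eqP ne; apply: h; exists m => //.
  by rewrite ms.
apply/clopenableC/clopenable_bigcup => m.
exact: (clopenable_coord m (fun k => (m < size s)%N && (k != nth 0%N s m))).
Qed.

(** By well-founded induction on [i]. The second clause allows any [g], not just the diagonal,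
    because the recursive parameters are tails of rows of [g z]. *)
Lemma universal_set (I : countType) (Rel : I -> I -> Prop) (i : I) :
  well_founded Rel ->
  exists U : (nat -> nat) -> set (nat -> nat),
    (forall E, sigmaB (copen (@bcode nat)) Rel i E -> exists a, U a = E) /\
    (forall g, clopenable_map g -> clopenable (fun z => U (g z) z)).
Proof.
move=> wf; elim/(well_founded_induction wf): i => i IH.
have /choice [V hV] : forall j, exists V : (nat -> nat) -> set (nat -> nat), Rel j i ->
    (forall E, sigmaB (copen (@bcode nat)) Rel j E -> exists a, V a = E) /\
    (forall g, clopenable_map g -> clopenable (fun z => V (g z) z)).
  move=> j; have [/IH[V hV]|n] := pselect (Rel j i); first by exists V.
  by exists (fun _ => set0).
exists (fun a => \bigcup_n universal_piece Rel V i (row a n)); split=> [E sE|g cg].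
  suff [W [WE /choice [b hb]]] : exists W : nat -> set (nat -> nat),
      E = \bigcup_n W n /\ forall n, exists b, universal_piece Rel V i b = W n.
    exists (fun k => let: (n, m) := odflt (0, 0)%N (unpickle k) in b n m).
    rewrite WE; apply: eq_bigcupr => n _; rewrite -hb; congr universal_piece.
    by apply/funext => m; rewrite /row pickleK.
  case: sE IH hV => {i} i => [A oA|j A ji sA] IH hV.
    exists (fun n => if unpickle n is Some s then
                       if `[< cyl (nth 0%N s) (size s) `<=` A >]
                       then cyl (nth 0%N s) (size s) else set0
                     else set0); split.
      apply/seteqP; split=> x.
        move=> Ax; have [n hn] := oA _ Ax.
        have ns m : (m < n)%N -> nth 0%N [seq x i | i <- iota 0 n] m = x m.
          by move=> mn; rewrite (nth_map 0%N) ?size_iota // nth_iota.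
        exists (pickle [seq x i | i <- iota 0 n]) => //.
        rewrite pickleK; case: ifPn => [_|/asboolPn[]].
          by move=> m; rewrite size_map size_iota => /ns.
        move=> y; rewrite /cyl size_map size_iota => hy; apply: hn.
        by apply/bcodeP => m mn; rewrite hy // ns.
      by move=> [n _]; case: (unpickle n) => // s; case: ifPn => // /asboolP; apply.
    move=> n; pose c (l : option (seq nat) + I) : nat -> nat := fun _ => pickle l.
    case: (unpickle n) => [s|]; last first.
      by exists (c (inl None)); rewrite /universal_piece pickleK.
    case: ifPn => _; last by exists (c (inl None)); rewrite /universal_piece pickleK.
    by exists (c (inl (Some s))); rewrite /universal_piece pickleK.
  exists A; split=> // n; case: (hV _ (ji n)) => /(_ _ (sA n)) [a ha] _.
  exists (fun m => if m is m'.+1 then a m' else pickle (inr (j n) : option (seq nat) + I)).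
  rewrite /universal_piece pickleK /=; case: ifPn => [_|/asboolPn//].
  by rewrite -[RHS]setCK -ha.
have -> : (fun z => (\bigcup_n universal_piece Rel V i (row (g z) n)) z) =
    \bigcup_n (fun z => universal_piece Rel V i (row (g z) n) z).
  by apply/seteqP; split.
apply: clopenable_bigcup => n.
pose l c : option (seq nat) + I := odflt (inl None) (unpickle c).
pose P c : set (nat -> nat) := fun z => match l c with
  | inl None => False
  | inl (Some s) => cyl (nth 0%N s) (size s) z
  | inr j => Rel j i /\ ~ V j (fun m => row (g z) n m.+1) z
  end.
(* Split by the tag [c]: once it is fixed, the piece is empty, a cylinder, or the complement of a
   set covered by the induction hypothesis. *)
have -> : (fun z => universal_piece Rel V i (row (g z) n) z) =
    \bigcup_c ((fun z => g z (pickle (n, 0%N)) = c) `&` P c).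
  have E z : universal_piece Rel V i (row (g z) n) z = P (g z (pickle (n, 0%N))) z.
    rewrite /universal_piece /P /l /row.
    case: (odflt _ _) => [[]//|j]; apply/propext.
    by case: ifPn => [/asboolP h|/asboolPn h]; split=> // -[].
  apply/seteqP; split=> z; rewrite E; first by move=> h; exists (g z (pickle (n, 0%N))).
  by move=> [c _ [/= ->]].
apply: clopenable_bigcup => c; apply: clopenableI; first exact: cg.
rewrite /P; case: (l c) => [[s|]|j]; [exact: clopenable_cyl|exact: clopenable0|].
have [ji|nji] := pselect (Rel j i); last first.
  have -> : (fun z => Rel j i /\ ~ V j (fun m => row (g z) n m.+1) z) = set0.
    by apply/seteqP; split=> z // [].
  exact: clopenable0.
have -> : (fun z => Rel j i /\ ~ V j (fun m => row (g z) n m.+1) z) =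
    ~` (fun z => V j (fun m => row (g z) n m.+1) z).
  by apply/seteqP; split=> z // [].
apply: clopenableC; case: (hV _ ji) => _; apply=> m k.
exact: cg.
Qed.

(** Cantor's diagonal argument on a universal set. *)
Lemma clopenable_not_sigmaB (I : countType) (Rel : I -> I -> Prop) (i : I) :
  well_founded Rel ->
  exists C, clopenable C /\ ~ sigmaB (copen (@bcode nat)) Rel i (~` C).
Proof.
move=> /universal_set -/(_ i) [U [univ /(_ (fun z => z)) cU]].
exists (fun z => U z z); split=> [|/univ [a Ua]].
  by apply: cU => m k; apply: (clopenable_coord m (fun c => c = k)).
have : U a a <-> ~ U a a by rewrite {1}Ua.
tauto.
Qed.

(** * Baire category in sequence spaces *)

Definition nowhere_dense (K : Type) (F : set (nat -> K)) : Prop :=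
  forall x n, exists y m, cyl y m `<=` cyl x n /\ cyl y m `<=` ~` F.

Definition meager (K : Type) (A : set (nat -> K)) : Prop :=
  exists F : nat -> set (nat -> K),
    (forall n, nowhere_dense (F n)) /\ A `<=` \bigcup_n F n.

(** [A] is comeager in the cylinder. *)
Definition forces (K : Type) (x : nat -> K) (n : nat) (A : set (nat -> K)) : Prop :=
  meager (cyl x n `\` A).

(** The Baire property in local form, which avoids naming an open set equal to [A] modulo a meager
    set. *)
Definition has_bp (K : Type) (A : set (nat -> K)) : Prop :=
  forall x n, exists y m,
    cyl y m `<=` cyl x n /\ (forces y m A \/ forces y m (~` A)).

Lemma cyl_refl (K : Type) (x : nat -> K) n : cyl x n x.
Proof. by []. Qed.

Lemma cyl_sub (K : Type) (x y : nat -> K) n m :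
  cyl x n y -> (n <= m)%N -> cyl y m `<=` cyl x n.
Proof. by move=> xy nm z yz k kn; rewrite yz ?xy //; apply: leq_trans nm. Qed.

Lemma meager_sub (K : Type) (A B : set (nat -> K)) :
  A `<=` B -> meager B -> meager A.
Proof. by move=> AB [F [hF BF]]; exists F; split=> // x /AB /BF. Qed.

Lemma meager_bigcup (K : Type) (A : nat -> set (nat -> K)) :
  (forall n, meager (A n)) -> meager (\bigcup_n A n).
Proof.
move=> /choice [F hF].
exists (fun k => let: (n, m) := odflt (0, 0)%N (unpickle k) in F n m); split.
  by move=> k; case: (odflt _ _) => n m; case: (hF n).
move=> x [n _ Anx]; case: (hF n) => _ /(_ _ Anx) [m _ Fx].
by exists (pickle (n, m)) => //; rewrite pickleK.
Qed.

Lemma nowhere_dense0 (K : Type) : nowhere_dense (@set0 (nat -> K)).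
Proof. by move=> x n; exists x, n; split=> // y _ []. Qed.

Lemma nowhere_dense_meager (K : Type) (A : set (nat -> K)) :
  nowhere_dense A -> meager A.
Proof. by move=> h; exists (fun _ => A); split=> // x; exists 0%N. Qed.

Lemma meager0 (K : Type) (A : set (nat -> K)) : (forall x, ~ A x) -> meager A.
Proof.
move=> h; apply: (@meager_sub _ _ set0) => [x /h//|].
exact/nowhere_dense_meager/nowhere_dense0.
Qed.

Lemma meagerU (K : Type) (A B : set (nat -> K)) :
  meager A -> meager B -> meager (A `|` B).
Proof.
move=> mA mB; rewrite -bigcup2E; apply: meager_bigcup => -[|[|n]] //=.
by apply: meager0 => x [].
Qed.

Lemma baire_category (K : Type) (A : set (nat -> K)) x n :
  meager A -> exists z, cyl x n z /\ ~ A z.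
Proof.
move=> [F [nF AF]].
have /choice [f hf] : forall t : nat * ((nat -> K) * nat), exists u,
    cyl u.1 u.2 `<=` cyl t.2.1 t.2.2 /\ cyl u.1 u.2 `<=` ~` F t.1 /\ (t.1 < u.2)%N.
  move=> [k [y m]] /=; have [y' [m' [h1 h2]]] := nF k y m.
  (* Length above [k] makes the nested cylinders shrink to a point, the diagonal sequence [z]
     below. *)
  exists (y', maxn m' k.+1) => /=.
  have h : cyl y' (maxn m' k.+1) `<=` cyl y' m' by apply: cyl_sub => //; lia.
  by split; [exact: subset_trans h1|split; [exact: subset_trans h2|lia]].
pose g := fix g k := if k is k'.+1 then f (k', g k') else (x, n).
have gS k : g k.+1 = f (k, g k) by [].
have sub k j : cyl (g (j + k)%N).1 (g (j + k)%N).2 `<=` cyl (g k).1 (g k).2.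
  elim: j => // j IH; rewrite addSn gS; apply: subset_trans IH.
  by case: (hf (j + k, g (j + k)))%N.
have lev k : (k <= (g k).2)%N by case: k => // k; case: (hf (k, g k)) => _ [].
pose z i := (g i.+1).1 i.
have gz k : cyl (g k).1 (g k).2 z.
  move=> i ik; rewrite /z; have [h|h] := leqP k i.+1.
    by have := sub k (i.+1 - k)%N; rewrite subnK // => /(_ _ (@cyl_refl _ _ _)) ->.
  have := sub i.+1 (k - i.+1)%N; rewrite subnK ?(ltnW h) // => /(_ _ (@cyl_refl _ _ _)) -> //.
exists z; split; first exact: (gz 0%N).
by move=> /AF [k _]; case: (hf (k, g k)) => _ [/(_ z (gz k.+1)) h _ /h].
Qed.

Lemma forces_sub (K : Type) (x y : nat -> K) n m (A B : set (nat -> K)) :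
  cyl y m `<=` cyl x n -> A `<=` B -> forces x n A -> forces y m B.
Proof. by move=> s AB; apply: meager_sub => z [/s xz nB]; split=> // /AB. Qed.

Lemma forces_consistent (K : Type) (x : nat -> K) n (A : set (nat -> K)) :
  forces x n A -> ~ forces x n (~` A).
Proof.
move=> h /(meagerU h) /(@baire_category _ _ x n) [z [xz]]; apply.
by have [Az|nAz] := pselect (A z); [right; split=> // /(_ Az)|left].
Qed.

(** The cylinders in which [A] is comeager cover a dense open part of [cyl x n], so what they miss
    is nowhere dense. As [K] is countable there are countably many of them, and their exceptional
    sets add up to a meager set. *)
Lemma forces_local (K : countType) (k0 : K) (x : nat -> K) n (A : set (nat -> K)) :
  (forall y m, cyl y m `<=` cyl x n ->
     exists y' m', cyl y' m' `<=` cyl y m /\ forces y' m' A) ->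
  forces x n A.
Proof.
move=> h; pose u (k : nat) : seq K := odflt [::] (unpickle k).
pose c k := cyl (nth k0 (u k)) (size (u k)).
pose B k := if `[< forces (nth k0 (u k)) (size (u k)) A >] then c k else set0.
have mB : meager (\bigcup_k (B k `\` A)).
  apply: meager_bigcup => k; rewrite /B; case: ifPn => [/asboolP//|_].
  by apply: meager0 => z [].
have : nowhere_dense (cyl x n `\` \bigcup_k B k).
  move=> y m; have [[w [yw xw]]|ne] := pselect (exists w, cyl y m w /\ cyl x n w); last first.
    by exists y, m; split=> // z yz [xz _]; apply: ne; exists z.
  have [|y' [m' [s f]]] := h w (maxn n m); first by apply: cyl_sub => //; lia.
  exists y', m'; split.
    by apply: (subset_trans s); apply: cyl_sub => //; lia.
  move=> z yz [_]; apply; exists (pickle [seq y' i | i <- iota 0 m']) => //.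
  have nE i : (i < m')%N -> nth k0 [seq y' i | i <- iota 0 m'] i = y' i.
    by move=> im; rewrite (nth_map 0%N) ?size_iota // nth_iota.
  have cE : cyl (nth k0 [seq y' i | i <- iota 0 m']) (size [seq y' i | i <- iota 0 m'])
      = cyl y' m'.
    rewrite size_map size_iota; apply/seteqP.
    by split=> v hv i im; rewrite hv ?nE.
  by rewrite /B /c /u pickleK /= /forces cE; case: ifPn => // /asboolPn.
move=> /nowhere_dense_meager /meagerU /(_ mB); apply: meager_sub => z [xz nA].
have [[k _ Bz]|nB] := pselect ((\bigcup_k B k) z); last by left.
by right; exists k.
Qed.

Lemma has_bpC (K : Type) (A : set (nat -> K)) : has_bp A -> has_bp (~` A).
Proof.
by move=> h x n; have [y [m [s f]]] := h x n; exists y, m; rewrite setCK; tauto.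
Qed.

Lemma has_bp_forcesC (K : countType) (k0 : K) (x : nat -> K) n (A : set (nat -> K)) :
  has_bp A -> (forall y m, cyl y m `<=` cyl x n -> ~ forces y m A) ->
  forces x n (~` A).
Proof.
move=> bA h; apply: forces_local => // y m s; have [y' [m' [s' []]]] := bA y m.
  by move=> /h; case; apply: subset_trans s.
by exists y', m'.
Qed.

(** If no [A k] is comeager in any subcylinder, the Baire property makes each [A k], hence the
    union, meager in [cyl x n]. *)
Lemma forces_bigcup (K : countType) (k0 : K) (x : nat -> K) n (A : nat -> set (nat -> K)) :
  (forall k, has_bp (A k)) ->
  forces x n (~` \bigcup_k A k) \/
  exists k y m, cyl y m `<=` cyl x n /\ forces y m (A k).
Proof.
move=> bA; have [h|h] := pselect (exists k y m, cyl y m `<=` cyl x n /\ forces y m (A k)).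
  by right.
left; have : forall k, forces x n (~` A k).
  move=> k; apply: (has_bp_forcesC k0) => // y m s f; apply: h; by exists k, y, m.
move=> /meager_bigcup; apply: meager_sub => z [xz] /contrapT [k _ Az].
by exists k => //; split=> //; apply.
Qed.

Lemma has_bp_bigcup (K : countType) (k0 : K) (A : nat -> set (nat -> K)) :
  (forall k, has_bp (A k)) -> has_bp (\bigcup_k A k).
Proof.
move=> bA x n; have [h|[k [y [m [s f]]]]] := forces_bigcup k0 x n bA.
  by exists x, n; split=> //; right.
exists y, m; split=> //; left; apply: forces_sub f => // z Az; by exists k.
Qed.

Lemma has_bp_trivial (K : Type) (P : Prop) : has_bp (fun _ : nat -> K => P).
Proof.
move=> x n; exists x, n; split=> //.
by have [p|np] := pselect P; [left|right]; apply: meager0 => z [_]; apply.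
Qed.

Lemma has_bpI (K : countType) (k0 : K) (A B : set (nat -> K)) :
  has_bp A -> has_bp B -> has_bp (A `&` B).
Proof.
move=> bA bB; rewrite -[A `&` B]setCK setCI -bigcup2E; apply: has_bpC.
apply: (has_bp_bigcup k0) => -[|[|k]] /=; try exact: has_bpC.
exact: has_bp_trivial False.
Qed.

Lemma has_bp_cyl (K : Type) (x : nat -> K) n : has_bp (cyl x n).
Proof.
move=> y m; have [[z [yz xz]]|h] := pselect (exists z, cyl y m z /\ cyl x n z).
  exists z, (maxn m n); split; first by apply: cyl_sub => //; lia.
  left; apply: meager0 => w [zw []]; move: w zw; apply: cyl_sub => //; lia.
exists y, m; split=> //; right; apply: meager0 => z [yz /contrapT xz].
by apply: h; exists z.
Qed.

Definition shift (G : zmodType) (k x : nat -> G) : nat -> G := fun m => (x m - k m)%R.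

Lemma shiftK (G : zmodType) (k x : nat -> G) : shift (fun m => - k m)%R (shift k x) = x.
Proof. by apply/funext => m; rewrite /shift opprK subrK. Qed.

Lemma shiftNK (G : zmodType) (k x : nat -> G) : shift k (shift (fun m => - k m)%R x) = x.
Proof. by apply/funext => m; rewrite /shift opprK addrK. Qed.

Lemma cyl_shift (G : zmodType) (k x y : nat -> G) n :
  cyl (shift k x) n (shift k y) <-> cyl x n y.
Proof.
by split=> h m mn; [have /addIr := h m mn|rewrite /shift h].
Qed.

Lemma meager_shift (G : zmodType) (k : nat -> G) (A : set (nat -> G)) :
  meager A -> meager (fun x => A (shift k x)).
Proof.
move=> [F [nF AF]]; exists (fun n x => F n (shift k x)); split; last first.
  by move=> x /AF [n _ Fn]; exists n.
move=> i x n; have [y [m [s1 s2]]] := nF i (shift k x) n.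
exists (shift (fun j => - k j)%R y), m; split=> z hz.
  by apply/(cyl_shift k)/s1; rewrite -(shiftNK k y); apply/cyl_shift.
by apply: s2; rewrite -(shiftNK k y); apply/cyl_shift.
Qed.

Lemma forces_shift (G : zmodType) (k x : nat -> G) n (A : set (nat -> G)) :
  forces (shift k x) n A <-> forces x n (fun y => A (shift k y)).
Proof.
split=> [/(meager_shift k)|/(meager_shift (fun m => - k m)%R)].
  by apply: meager_sub => z [xz nA]; split=> //; apply/cyl_shift.
apply: meager_sub => z [xz nA]; split; last by rewrite shiftNK.
by apply/(cyl_shift k); rewrite shiftNK.
Qed.

Lemma has_bp_shift (G : zmodType) (k : nat -> G) (A : set (nat -> G)) :
  has_bp A -> has_bp (fun x => A (shift k x)).
Proof.
move=> bA x n; have [y [m [s f]]] := bA (shift k x) n.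
exists (shift (fun j => - k j)%R y), m; split.
  move=> z hz; apply/(cyl_shift k)/s; rewrite -(shiftNK k y); exact/cyl_shift.
rewrite -(shiftNK k y) in f; case: f => f; [left|right].
  exact/(forces_shift k _ _ A).
exact/(forces_shift k _ _ (~` A)).
Qed.

(** * Open sets of finer Polish topologies have the Baire property *)

Lemma polish_basis (X : Type) (O : set (set X)) : polish_top O ->
  exists b : nat -> set X, (forall k, O (b k)) /\
    forall U x, O U -> U x -> exists k, b k x /\ b k `<=` U.
Proof.
move=> [[d [d0 [dC [dT [dO _]]]]] [D [/countable_injP [f finj] Ddense]]].
have ballO x e : O (fun y => Rlt (d x y) e).
  apply/dO => y xy; exists (Rminus e (d x y)); split; first lra.
  by move=> z yz; have := dT x y z; lra.
(* The ball of radius [eps n] about the point of [D] numbered [i], or the empty set if there is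
   none. *)
pose b k : set X := let: (i, n) := odflt (0, 0)%N (unpickle k) in
  fun y => exists p, [/\ D p, f p = i & Rlt (d p y) (eps n)].
exists b; split.
  move=> k; rewrite /b; case: (odflt _ _) => i n; apply/dO => y [p [Dp fp py]].
  exists (Rminus (eps n) (d p y)); split; first lra.
  by move=> z yz; exists p; split=> //; have := dT p y z; lra.
move=> U x OU Ux; have [e [e0 eU]] := (dO U).1 OU x Ux.
have [n ne] : exists n, Rlt (eps n) (Rmult e (Rinv 2)) by apply: eps_small; lra.
have xx y : d y y = IZR 0 by apply/d0.
have [p [Dp xp]] : D `&` (fun y => Rlt (d x y) (eps n)) !=set0.
  by apply: Ddense => //; exists x; rewrite xx; exact: eps_gt0.
exists (pickle (f p, n)); rewrite /b pickleK /=; split.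
  by exists p; split=> //; rewrite dC.
move=> y [p' [Dp' fp' py]]; apply: eU.
have {}fp' : p' = p by apply: finj => //; rewrite inE.
rewrite fp' in py.
by have := dT x p y; rewrite /= in xp *; lra.
Qed.

Definition bp_separated (K : Type) (P Q : set (nat -> K)) : Prop :=
  exists E, [/\ has_bp E, P `<=` E & Q `<=` ~` E].

Lemma bp_separated_bigcup (K : countType) (k0 : K) (P Q : set (nat -> K))
  (P' Q' : nat -> set (nat -> K)) :
  P `<=` \bigcup_i P' i -> Q `<=` \bigcup_j Q' j ->
  (forall i j, bp_separated (P' i) (Q' j)) -> bp_separated P Q.
Proof.
move=> PP QQ h.
have {h} /choice [E hE] : forall i, exists E : nat -> set (nat -> K),
    forall j, [/\ has_bp (E j), P' i `<=` E j & Q' j `<=` ~` E j].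
  by move=> i; have /choice [E hE] := h i; exists E.
(* The union over [i] of the intersections over [j] of [E i j]. *)
exists (\bigcup_i ~` \bigcup_j ~` E i j); split.
- apply: (has_bp_bigcup k0) => i; apply/has_bpC/(has_bp_bigcup k0) => j.
  by apply: has_bpC; case: (hE i j).
- move=> x /PP [i _ Px]; exists i => // -[j _]; apply.
  by case: (hE i j) => _ h _; apply: h.
- move=> x /QQ [j _ Qx] [i _]; apply; exists j => //.
  by case: (hE i j) => _ _; apply.
Qed.

(* Lusin's separation argument: two inseparable closed sets would contain
   points x and y that no clopen set of the coarse topology separates. *)
Lemma bp_separated_closed (K : countType) (k0 : K) (O : set (set (nat -> K)))
  (F1 F2 : set (nat -> K)) :
  (forall U, copen (@bcode K) U -> O U) -> polish_top O ->
  O (~` F1) -> O (~` F2) -> F1 `&` F2 = set0 -> bp_separated F1 F2.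
Proof.
move=> finer pO oF1 oF2 F12; apply: contrapT => nsep.
have [b [bO bU]] := polish_basis pO.
case: pO => [[d [d0 [dC [dT [dO cpl]]]]] _].
have xx y : d y y = IZR 0 by apply/d0.
have ballO x e : O (fun y => Rlt (d x y) e).
  apply/dO => y xy; exists (Rminus e (d x y)); split; first lra.
  by move=> z yz; have := dT x y z; lra.
pose small n k : set (nat -> K) :=
  if `[< forall y z, b k y -> b k z -> Rlt (d y z) (eps n) >] then b k else set0.
have smallP n k y z : small n k y -> small n k z -> Rlt (d y z) (eps n).
  by rewrite /small; case: ifPn => [/asboolP h|_ //]; apply: h.
have cover n x : exists k, small n k x.
  have e0 := eps_gt0 n.
  have [|k [bx bs]] := bU _ x (ballO x (Rmult (eps n) (Rinv 2))).
    by rewrite xx; lra.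
  exists k; rewrite /small; case: ifPn => // /asboolPn []; move=> y z /bs xy /bs xz.
  by have := dT y x z; rewrite (dC y x); move: xy xz => /=; lra.
(* Cut both sets into countably many pieces of diameter below [eps n]. By [bp_separated_bigcup], an
   inseparable pair has an inseparable pair of pieces. *)
have /choice [f hf] : forall t : nat * (set (nat -> K) * set (nat -> K)), exists u,
    ~ bp_separated t.2.1 t.2.2 ->
    [/\ ~ bp_separated u.1 u.2, u.1 `<=` t.2.1, u.2 `<=` t.2.2,
     forall y z, u.1 y -> u.1 z -> Rlt (d y z) (eps t.1) &
     forall y z, u.2 y -> u.2 z -> Rlt (d y z) (eps t.1)].
  move=> [n [P Q]] /=.
  have [[i [j h]]|h] := pselect (exists i j,
      ~ bp_separated (P `&` small n i) (Q `&` small n j)).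
    exists (P `&` small n i, Q `&` small n j) => _; split=> //=; try exact: subIsetl.
    - by move=> y z [_ hy] [_ hz]; apply: smallP hy hz.
    - by move=> y z [_ hy] [_ hz]; apply: smallP hy hz.
  exists (P, Q) => -[]; apply: (@bp_separated_bigcup _ k0 _ _
     (fun i => P `&` small n i) (fun j => Q `&` small n j)).
  - by move=> x Px; have [k hk] := cover n x; exists k.
  - by move=> x Qx; have [k hk] := cover n x; exists k.
  - by move=> i j; apply: contrapT => ns; apply: h; exists i, j.
pose g := fix g k := if k is k'.+1 then f (k', g k') else (F1, F2).
have gS k : g k.+1 = f (k, g k) by [].
have gN k : ~ bp_separated (g k).1 (g k).2.
  by elim: k => // k IH; rewrite gS; case: (hf (k, g k) IH).
have mono k j : (g (j + k)%N).1 `<=` (g k).1 /\ (g (j + k)%N).2 `<=` (g k).2.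
  elim: j => [|j [IH1 IH2]]; [by rewrite add0n; split|rewrite addSn gS].
  case: (hf (j + k, g (j + k))%N (gN _)) => _ s1 s2 _ _.
  by split; [apply: subset_trans IH1|apply: subset_trans IH2].
(* Used for both components: points picked in the shrinking sets converge to a point of the closed
   set [F], and each neighbourhood of it contains a whole stage. *)
have lim (pr : set (nat -> K) * set (nat -> K) -> set (nat -> K)) (F : set (nat -> K)) :
    (forall k, pr (g k) !=set0) -> (forall k j, pr (g (j + k)%N) `<=` pr (g k)) ->
    (forall k y z, pr (g k.+1) y -> pr (g k.+1) z -> Rlt (d y z) (eps k)) ->
    pr (g 0%N) = F -> O (~` F) ->
    exists2 x, F x & forall U, O U -> U x -> exists N, pr (g N) `<=` U.
  move=> ne mo dia <- oF.
  have /choice [u hu] := fun k => ne k.+1.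
  have ug k m : (k <= m)%N -> pr (g k.+1) (u m).
    by move=> km; apply: (mo k.+1 (m - k)%N); rewrite addnS subnK.
  have [e e0|x hx] := cpl u.
    have [n ne'] := eps_small e0; exists n => m k nm nk.
    by apply: Rlt_trans ne'; apply: dia; apply: ug.
  have near U : O U -> U x -> exists N, pr (g N) `<=` U.
    move=> OU Ux; have [e [e0 eU]] := (dO U).1 OU x Ux.
    have [n ne'] : exists n, Rlt (eps n) (Rmult e (Rinv 2)) by apply: eps_small; lra.
    have [|N hN] := hx (Rmult e (Rinv 2)); first lra.
    exists n.+1 => y gy; apply: eU.
    have := hN (maxn n N) (leq_maxr _ _).
    have := dia n (u (maxn n N)) y (ug _ _ (leq_maxl _ _)) gy.
    by have := dT x (u (maxn n N)) y; rewrite (dC x (u _)); lra.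
  exists x => //; apply: contrapT => nFx.
  have [N hN] := near _ oF nFx; have [y gy] := ne N.
  by apply: (hN y gy); apply: (mo 0%N N); rewrite addn0.
have ne1 k : (g k).1 !=set0.
  apply: contrapT => e; apply: (gN k); exists set0; split.
  - exact: has_bp_trivial False.
  - by move=> x hx; apply: e; exists x.
  - by move=> x _ [].
have ne2 k : (g k).2 !=set0.
  apply: contrapT => e; apply: (gN k); exists setT; split.
  - exact: has_bp_trivial True.
  - by [].
  - by move=> x hx; exfalso; apply: e; exists x.
have [||x F1x nx] := lim fst F1 ne1 _ _ erefl oF1.
- by move=> k j; case: (mono k j).
- by move=> k y z; rewrite gS; case: (hf (k, g k) (gN _)) => _ _ _ h _; apply: h.
have [||y F2y ny] := lim snd F2 ne2 _ _ erefl oF2.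
- by move=> k j; case: (mono k j).
- by move=> k y' z; rewrite gS; case: (hf (k, g k) (gN _)) => _ _ _ _ h; apply: h.
have [n xy] : exists n, x n <> y n.
  apply: contrapT => h; have xy : x = y.
    by apply/funext => n; apply: contrapT => ne; apply: h; exists n.
  have : (F1 `&` F2) x by split=> //; rewrite xy.
  by rewrite F12.
(* [cyl x n.+1] is clopen in the coarse topology and omits [y], so at a late stage it separates the
   two components, contradicting [gN]. *)
have [||N hN] := nx (cyl x n.+1); [|by []|].
  apply: finer => z xz; exists n.+1 => w /bcodeP zw m mn.
  by rewrite -zw // xz.
have [||M hM] := ny (~` cyl x n.+1).
- apply: finer => z xz; exists n.+1 => w /bcodeP zw xw; apply: xz => m mn.
  by rewrite zw // xw.
- by move=> /(_ n (ltnSn n)) e; apply: xy.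
apply: (gN (N + M)%N); exists (cyl x n.+1); split; first exact: has_bp_cyl.
  by apply: subset_trans hN; rewrite addnC; case: (mono N M).
by apply: subset_trans hM; case: (mono M N).
Qed.

(** [U] is the union of the closed sets [F n]. Each is separated from the complement of [U] by some
    [E n] with the Baire property, and these [E n] also have union [U]. *)
Lemma has_bp_finer (K : countType) (k0 : K) (O : set (set (nat -> K))) U :
  (forall U, copen (@bcode K) U -> O U) -> polish_top O -> O U -> has_bp U.
Proof.
move=> finer pO oU; have [[d [d0 [dC [dT [dO _]]]]] _] := pO.
pose F n : set (nat -> K) := fun x => forall y, Rlt (d x y) (eps n) -> U y.
have FU n : F n `<=` U.
  by move=> x; apply; rewrite (d0 x x).2 //; exact: eps_gt0.
have cF n : O (~` F n).
  apply/dO => x /existsNP [y /not_implyP [xy nUy]].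
  exists (Rminus (eps n) (d x y)); split; first lra.
  by move=> z xz Fz; apply: nUy; apply: Fz; have := dT z x y; rewrite (dC z x); lra.
have /choice [E hE] : forall n, bp_separated (F n) (~` U).
  move=> n; apply: (bp_separated_closed k0 finer pO) => //; first by rewrite setCK.
  by apply/seteqP; split=> // x [/FU].
have -> : U = \bigcup_n E n.
  apply/seteqP; split=> x.
    move=> /((dO U).1 oU) [e [e0 eU]]; have [n ne] := eps_small e0.
    exists n => //; case: (hE n) => _ h _; apply: h => y xy; apply: eU; lra.
  by move=> [n _ Ex]; apply: contrapT => nU; case: (hE n) => _ _ /(_ x nU).
by apply: (has_bp_bigcup k0) => n; case: (hE n).
Qed.

(** * The category transform of a set of pairs *)

Definition trace (G : zmodType) (phi : (nat -> nat) -> nat -> G)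
  (W : set ((nat -> G) * (nat -> G))) (z : nat -> nat) : set (nat -> G) :=
  fun x => W (x, shift (phi z) x).

(** A Vaught transform: for traces with the Baire property and countable [G], it says that the trace
    is non-meager in [cyl x n]. *)
Definition somewhere_forced (G : zmodType) (phi : (nat -> nat) -> nat -> G)
  (W : set ((nat -> G) * (nat -> G))) (x : nat -> G) (n : nat) : set (nat -> nat) :=
  fun z => exists y m, cyl y m `<=` cyl x n /\ forces y m (trace phi W z).

Lemma prod_top_bigcup (X Y : Type) (O1 : set (set X)) (O2 : set (set Y))
  (W : set (X * Y)) :
  polish_top O1 -> polish_top O2 -> prod_top O1 O2 W ->
  exists U V, (forall k : nat, O1 (U k) /\ O2 (V k)) /\
    W = \bigcup_k [set p | U k p.1 /\ V k p.2].
Proof.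
move=> p1 p2 oW; have [b1 [ob1 b1P]] := polish_basis p1.
have [b2 [ob2 b2P]] := polish_basis p2.
have [[p0 Wp0]|W0] := pselect (exists p, W p); last first.
  have [U [oU UE]] : exists U, O1 U /\ U = set0.
    case: p1 => [[d [_ [_ [_ [dO _]]]]] _].
    by exists set0; split=> //; apply/dO.
  exists (fun _ => U), (fun _ => b2 0%N); split=> //; rewrite UE.
  apply/seteqP; split=> p; first by move=> Wp; case: W0; exists p.
  by move=> [k _ []].
(* A rectangle inside [W], substituted for the basic rectangles that are not contained in [W]. *)
have [U0 [V0 [oU0 oV0 _ _ UV0]]] := oW _ Wp0.
pose good k := [set p | b1 k.1 p.1 /\ b2 k.2 p.2] `<=` W.
pose c k : nat * nat := odflt (0, 0)%N (unpickle k).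
exists (fun k => if `[< good (c k) >] then b1 (c k).1 else U0).
exists (fun k => if `[< good (c k) >] then b2 (c k).2 else V0).
split; first by move=> k; case: ifPn.
apply/seteqP; split=> [p Wp|p [k _]].
  have [U [V [oU oV Up Vp UVW]]] := oW _ Wp.
  have [i [bi bU]] := b1P _ _ oU Up; have [j [bj bV]] := b2P _ _ oV Vp.
  exists (pickle (i, j)) => //; rewrite /c pickleK /=; case: ifPn => // /asboolPn [].
  by move=> q [/= /bU Uq /bV Vq]; apply: UVW.
by case: ifPn => [/asboolP h|_] [h1 h2]; [apply: h|apply: UV0].
Qed.

Lemma trace_bigcup (G : zmodType) (phi : (nat -> nat) -> nat -> G)
  (A : nat -> set ((nat -> G) * (nat -> G))) z :
  trace phi (\bigcup_k A k) z = \bigcup_k trace phi (A k) z.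
Proof. by apply/seteqP; split. Qed.

Lemma has_bp_trace_rect (G : countZmodType) (phi : (nat -> nat) -> nat -> G)
  (O1 O2 : set (set (nat -> G))) (U V : set (nat -> G)) z :
  (forall U, copen (@bcode G) U -> O1 U) -> polish_top O1 ->
  (forall V, copen (@bcode G) V -> O2 V) -> polish_top O2 ->
  O1 U -> O2 V -> has_bp (trace phi [set p | U p.1 /\ V p.2] z).
Proof.
move=> f1 p1 f2 p2 oU oV.
apply: (@has_bpI G 0%R U (fun x => V (shift (phi z) x))).
  exact: (has_bp_finer 0%R f1 p1 oU).
exact/has_bp_shift/(has_bp_finer 0%R f2 p2 oV).
Qed.

Lemma has_bp_trace (G : countZmodType) (phi : (nat -> nat) -> nat -> G)
  (O1 O2 : set (set (nat -> G))) (I : Type) (Rel : I -> I -> Prop) (i : I) W z :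
  (forall U, copen (@bcode G) U -> O1 U) -> polish_top O1 ->
  (forall V, copen (@bcode G) V -> O2 V) -> polish_top O2 ->
  sigmaB (prod_top O1 O2) Rel i W -> has_bp (trace phi W z).
Proof.
move=> f1 p1 f2 p2; elim=> {i W} [i W oW|i j A ji _ IH].
  have [U [V [oUV ->]]] := prod_top_bigcup p1 p2 oW.
  rewrite trace_bigcup; apply: (has_bp_bigcup 0%R) => k; case: (oUV k) => oU oV.
  exact: has_bp_trace_rect f1 p1 f2 p2 oU oV.
rewrite trace_bigcup; apply: (has_bp_bigcup 0%R) => k.
by have /has_bpC := IH k; rewrite /trace /setC; under eq_fun do rewrite notK.
Qed.

(** Induction along the hierarchy, for all cylinders at once. For open [W] a rectangle is forced, a
    condition on finitely many entries of [z]. A union is non-meager exactly when, for some [k] and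
    some subcylinder, the complement of [A k] is meager there, which negates a condition of lower
    level. *)
Lemma somewhere_forced_sigmaB (G : countZmodType) (phi : (nat -> nat) -> nat -> G)
  (O1 O2 : set (set (nat -> G))) (I : Type) (Rel : I -> I -> Prop) (i : I) W x n :
  (forall z z' n, (forall m, (m < n)%N -> z m = z' m) ->
     forall m, (m < n)%N -> phi z m = phi z' m) ->
  (forall U, copen (@bcode G) U -> O1 U) -> polish_top O1 ->
  (forall V, copen (@bcode G) V -> O2 V) -> polish_top O2 ->
  sigmaB (prod_top O1 O2) Rel i W ->
  sigmaB (copen (@bcode nat)) Rel i (somewhere_forced phi W x n).
Proof.
move=> lip f1 p1 f2 p2 sW; elim: sW x n => {i W} [i W oW|i j A ji sA IH] x n.
  apply: sigmaB_open.
  have [U [V [oUV ->]]] := prod_top_bigcup p1 p2 oW.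
  move=> z [y [m [s]]]; rewrite trace_bigcup => f.
  have bp k : has_bp (trace phi [set p | U k p.1 /\ V k p.2] z).
    case: (oUV k) => oU oV; exact: has_bp_trace_rect f1 p1 f2 p2 oU oV.
  have [/(forces_consistent f)//|[k [y' [m' [s' f']]]]] := forces_bigcup 0%R y m bp.
  have fU : forces y' m' (U k) by apply: forces_sub f' => // w [].
  have fV : forces (shift (phi z) y') m' (V k).
    by apply/forces_shift; apply: forces_sub f' => // w [].
  exists m' => z' /bcodeP zz'; exists y', m'; split; first exact: subset_trans s.
  (* By [lip], the translates of [y'] by [phi z] and [phi z'] determine the same cylinder of length
     [m']. *)
  have {}fV : forces y' m' (fun w => V k (shift (phi z') w)).
    apply/(forces_shift (phi z') _ _ (V k)); apply: forces_sub fV => // w hw l lm.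
    by rewrite hw // /shift (lip _ _ _ zz').
  rewrite trace_bigcup; apply: (meager_sub _ (meagerU fU fV)) => w [yw nw].
  apply: contrapT => /not_orP [nU nV]; apply: nw; exists k => //.
  by split; apply: contrapT => h; [apply: nU|apply: nV].
pose c l : nat * seq G := odflt (0%N, [::]) (unpickle l).
(* The subcylinder coded by [l], with [cyl x n] itself as default, so that [t l] always stays inside
   [cyl x n]. *)
pose t l := if `[< cyl (nth 0%R (c l).2) (size (c l).2) `<=` cyl x n >]
  then (nth 0%R (c l).2, size (c l).2) else (x, n).
have -> : somewhere_forced phi (\bigcup_k A k) x n =
    \bigcup_l ~` somewhere_forced phi (~` A (c l).1) (t l).1 (t l).2.
  have bpA k z : has_bp (trace phi (~` A k) z).
    exact: has_bp_trace f1 p1 f2 p2 (sA k).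
  apply/seteqP; split=> z.
    move=> [y [m [s f]]]; rewrite trace_bigcup in f.
    have bp k : has_bp (trace phi (A k) z).
      by have /has_bpC := bpA k z; rewrite /trace /setC; under eq_fun do rewrite notK.
    have [/(forces_consistent f)//|[k [y' [m' [s' f']]]]] := forces_bigcup 0%R y m bp.
    pose q := [seq y' i | i <- iota 0 m'].
    have qE : cyl (nth 0%R q) (size q) = cyl y' m'.
      rewrite size_map size_iota; apply/seteqP.
      by split=> v hv l lm; rewrite hv // (nth_map 0%N) ?size_iota // nth_iota.
    exists (pickle (k, q)) => //; rewrite /t /c pickleK /= qE.
    have s2 : cyl y' m' `<=` cyl x n by apply: subset_trans s.
    case: ifPn => [_|/asboolPn//] /= -[y2 [m2 []]]; rewrite qE => s3 f3.
    by apply: (forces_consistent _ f3); apply: forces_sub f'.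
  move=> [l _ nf].
  have st : cyl (t l).1 (t l).2 `<=` cyl x n by rewrite /t; case: ifPn => [/asboolP|_] /=.
  have f : forces (t l).1 (t l).2 (~` trace phi (~` A (c l).1) z).
    by apply: (has_bp_forcesC 0%R (bpA _ _)) => y m s f; apply: nf; exists y, m.
  exists (t l).1, (t l).2; split=> //; apply: forces_sub f => // w /contrapT Aw.
  by exists (c l).1.
apply: (sigmaB_union (j := fun l => j (c l).1)) => l; first exact: ji.
by rewrite setCK; apply: IH.
Qed.

(** The trace of [D] at [z] is the whole space or empty according to [C z], so the transform of the
    complement of [D] over the whole space is the complement of [C]. *)
Lemma not_pot_separable (G : countZmodType) (phi : (nat -> nat) -> nat -> G)
  (O1 O2 : set (set (nat -> G))) (I : Type) (Rel : I -> I -> Prop) (i : I)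
  (C : set (nat -> nat)) D :
  (forall z z' n, (forall m, (m < n)%N -> z m = z' m) ->
     forall m, (m < n)%N -> phi z m = phi z' m) ->
  (forall U, copen (@bcode G) U -> O1 U) -> polish_top O1 ->
  (forall V, copen (@bcode G) V -> O2 V) -> polish_top O2 ->
  piB (prod_top O1 O2) Rel i D ->
  (forall x z, D (x, shift (phi z) x) <-> C z) ->
  sigmaB (copen (@bcode nat)) Rel i (~` C).
Proof.
move=> lip f1 p1 f2 p2 sD DC.
have := somewhere_forced_sigmaB (fun _ => 0%R) 0 lip f1 p1 f2 p2 sD.
congr sigmaB; apply/seteqP; split=> z.
  move=> [y [m [_ /(@baire_category _ _ y m) [w [yw h]]]]] Cz.
  by apply: h; split=> // nD; apply: nD; apply/DC.
move=> nC; exists (fun _ => 0%R), 0%N; split=> //.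
by apply: meager0 => x [_]; apply=> Dx; apply: nC; apply/DC; exact: Dx.
Qed.

(** * Translates of a Sidon family *)

Definition prefix_code (z : nat -> nat) (n : nat) : nat := pickle [seq z i | i <- iota 0 n].

Lemma prefix_code_inj z z' n m :
  prefix_code z n = prefix_code z' n -> (m < n)%N -> z m = z' m.
Proof.
move=> /(pcan_inj pickleK) /(congr1 (nth 0%N ^~ m)) + mn.
by rewrite !(nth_map 0%N) ?size_iota // !nth_iota.
Qed.

Lemma prefix_code_ext z z' n :
  (forall m, (m < n)%N -> z m = z' m) -> prefix_code z n = prefix_code z' n.
Proof.
move=> h; congr pickle; apply/eq_in_map => i; rewrite mem_iota add0n => /= ni.
exact: h.
Qed.

(* Two integers are determined, up to order, by their sum and the sum of their squares:
   this is why each prefix code occurs to the powers 1 and 2. *)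
Definition sidon (z : nat -> nat) : nat -> int :=
  fun m => ((prefix_code z m./2)%:Z ^+ (odd m).+1)%R.

(** A continuous left inverse of [sidon]: entry [i] is read from the prefix of length [i.+1], which
    stands to the power 1 at position [(i.+1).*2]. *)
Definition unsidon (k : nat -> int) : nat -> nat :=
  fun i => nth 0%N (odflt [::] (unpickle `|k (i.+1).*2|%N)) i.

Lemma sidonK z : unsidon (sidon z) = z.
Proof.
apply/funext => i; rewrite /unsidon /sidon odd_double doubleK expr1 absz_nat.
by rewrite /prefix_code pickleK /odflt /oapp (nth_map 0%N) ?size_iota // nth_iota.
Qed.

Lemma sidon_lip z z' n : (forall m, (m < n)%N -> z m = z' m) ->
  forall m, (m < n)%N -> sidon z m = sidon z' m.
Proof.
move=> h m mn; rewrite /sidon (@prefix_code_ext z z') // => i im; apply: h.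
by apply: leq_trans im _; apply: leq_trans (ltnW mn); lia.
Qed.

Lemma int_sidon (p q r s : int) :
  (p + s = q + r -> p ^+ 2 + s ^+ 2 = q ^+ 2 + r ^+ 2 -> p = q \/ p = r)%R.
Proof.
(* With [s = q + r - p], the two sums of squares differ by twice this product. *)
move=> h1 h2; have /eqP : ((p - q) * (p - r) = 0)%R.
  have {}h1 : s = (q + r - p)%R by rewrite -h1 addrC addKr.
  rewrite h1 in h2; nia.
by rewrite mulf_eq0 !subr_eq0 => /orP[/eqP|/eqP]; [left|right].
Qed.

(** At each length the prefix of [a] is that of [b] or of [c]; beyond a place where [a] and [b]
    differ it must be that of [c]. *)
Lemma sidonP a b c d :
  (forall m, sidon a m + sidon d m = sidon b m + sidon c m)%R -> a = b \/ a = c.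
Proof.
move=> h; have hn n : prefix_code a n = prefix_code b n \/ prefix_code a n = prefix_code c n.
  have := h n.*2; have := h n.*2.+1; rewrite /sidon /= odd_double uphalf_double doubleK /=.
  by rewrite ?expr1 => h2 h1; case: (int_sidon h1 h2) => -[]; [left|right].
have [|nab] := pselect (a = b); [by left|right].
have [m0 hm0] : exists m, a m <> b m.
  apply: contrapT => e; apply: nab; apply/funext => m; apply: contrapT => ne.
  by apply: e; exists m.
apply/funext => m; have [e|e] := hn (maxn m0 m).+1.
  by case: hm0; apply: (prefix_code_inj e); lia.
by apply: (prefix_code_inj e); lia.
Qed.

Definition graph (C : set (nat -> nat)) : set (coded (@bcode int) * coded (@bcode int)) :=
  [set p | exists x z, C z /\ p = (x, shift (sidon z) x)].

(** The four differences over a rectangle with corners [x], [x'], [y], [y'] satisfy the Sidon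
    equation. Then [z x y] is [z x' y], forcing [u x = u x'], or [z x y'], forcing [v y = v y']. *)
Lemma graph_rectangle (T1 T2 : Type) (u : T1 -> nat -> int) (v : T2 -> nat -> int)
  (z : T1 -> T2 -> nat -> nat) :
  (forall x y, v y = shift (sidon (z x y)) (u x)) ->
  (forall x x', u x = u x') \/ (forall y y', v y = v y').
Proof.
move=> h; have [|nu] := pselect (forall x x', u x = u x'); [by left|right] => y y'.
have /existsNP [x /existsNP [x' ne]] := nu.
have [e|e] : z x y = z x' y \/ z x y = z x y'.
- apply: (@sidonP _ _ _ (z x' y')) => m.
  have := h x y; have := h x y'; rewrite (h x' y) (h x' y').
  move=> /(congr1 (fun f => f m)) + /(congr1 (fun f => f m)); rewrite /shift; lia.
- case: ne; have := h x y; rewrite (h x' y) e.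
  move=> /(congr1 (shift (fun m => - sidon (z x' y) m)%R)).
  by rewrite !shiftK.
- by rewrite (h x y) (h x y') e.
Qed.

(** The Polish domain is the product of the sequences in [K] with [C], the latter under a finer
    topology in which [C] is clopen. *)
Lemma analytic_image (K : countType) (T1 T2 : Type) (P1 : T1 -> nat -> nat)
  (P2 : T2 -> nat -> nat) (f1 : (nat -> K) -> (nat -> nat) -> T1)
  (f2 : (nat -> K) -> (nat -> nat) -> T2) (C : set (nat -> nat)) :
  clopenable C ->
  (forall n, exists k, forall x z x' z', agree (@bcode K) k x x' ->
     (forall m, (m < k)%N -> z m = z' m) -> agree P1 n (f1 x z) (f1 x' z')) ->
  (forall n, exists k, forall x z x' z', agree (@bcode K) k x x' ->
     (forall m, (m < k)%N -> z m = z' m) -> agree P2 n (f2 x z) (f2 x' z')) ->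
  @analytic (coded P1 * coded P2)%type [set p | exists x z, C z /\ p = (f1 x z, f2 x z)].
Proof.
move=> [Phi [cl fin [l lC]]] c1 c2.
pose Z := {p : (nat -> K) * (nat -> nat) | C p.2}.
pose Psi (p : Z) n : nat := pickle ((sval p).1 n, Phi (sval p).2 n).
have PsiP n p p' : agree Psi n p p' ->
    agree (@bcode K) n (sval p).1 (sval p').1 /\ agree Phi n (sval p).2 (sval p').2.
  by move=> h; split=> m /h /(pcan_inj pickleK) [e1 e2]; rewrite /bcode ?e1 ?e2.
have /choice [N hN] := fin.
have agreeN n : exists k, forall p p', agree Psi k p p' ->
    agree (@bcode K) n (sval p).1 (sval p').1 /\
    (forall m, (m < n)%N -> (sval p).2 m = (sval p').2 m).
  have [M hM] := bounded_lt N n; exists (maxn n M) => p p' /PsiP [h1 h2].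
  split=> [|m mn]; first by apply: agree_le h1; lia.
  by apply: hN; apply: agree_le h2; have := hM m mn; lia.
exists (coded Psi), (fun p => (f1 (sval p).1 (sval p).2, f2 (sval p).1 (sval p).2)); split.
- apply: coded_polish.
    move=> p p' e; have h n : agree Psi n p p' by move=> m _; apply: e.
    case: p p' h {e} => [[x z] Cz] [[x' z'] Cz'] h; apply/eq_exist => /=.
    congr pair; apply/funext => m; have [k hk] := agreeN m.+1.
      by case: (hk _ _ (h k)) => /= /bcodeP -> //.
    by case: (hk _ _ (h k)) => /= _ -> //.
  move=> q hq.
  have /choice [r hr] : forall m, exists r : K * nat, q m = pickle r.
    by move=> m; have [p hp] := hq m.+1; rewrite -hp //; eexists.
  have hq' n : exists p : Z, forall m, (m < n)%N -> ((sval p).1 m, Phi (sval p).2 m) = r m.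
    have [p hp] := hq n; exists p => m /hp; rewrite hr => /(pcan_inj pickleK) <-.
    by [].
  have [z hz] : exists z, forall m, Phi z m = (r m).2.
    by apply: cl => n; have [p hp] := hq' n; exists (sval p).2 => m /hp <-.
  (* The first [l] code entries decide membership in [C], so the limit inherits it from an
     approximant. *)
  have Cz : C z.
    have [p hp] := hq' l; apply: (lC (sval p).2); last exact: (svalP p).
    by move=> m /hp; rewrite hz => <-.
  exists (exist _ (fun m => (r m).1, z) Cz) => m.
  by rewrite /Psi /= hz hr -surjective_pairing.
- have cf1 : continuous (fun p : coded Psi => f1 (sval p).1 (sval p).2 : coded P1).
    apply: coded_continuous => p n.
    have [k hk] := c1 n; have [k' hk'] := agreeN k; exists k' => p' /hk' [h1 h2].
    exact: hk.
  have cf2 : continuous (fun p : coded Psi => f2 (sval p).1 (sval p).2 : coded P2).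
    apply: coded_continuous => p n.
    have [k hk] := c2 n; have [k' hk'] := agreeN k; exists k' => p' /hk' [h1 h2].
    exact: hk.
  by move=> p; apply: (cvg_pair (cf1 p) (cf2 p)).
apply/seteqP; split=> [_ [[[x z] Cz] _ <-]|_ [x [z [Cz ->]]]].
  by exists x, z.
by exists (exist _ (x, z) Cz).
Qed.

(** * Refuting the dichotomy *)

Lemma clopenable_polish (C : set (nat -> nat)) : clopenable C ->
  exists O : set (set (nat -> nat)),
    [/\ polish_top O, (forall U, copen (@bcode nat) U -> O U), O C & O (~` C)].
Proof.
move=> [Phi [cl fin [n nC]]]; have /choice [N hN] := fin; exists (copen Phi); split.
- apply: coded_polish => // x y e; apply/funext => m.
  by apply: hN => k _; apply: e.
- move=> U oU x /oU [k kU]; have [M hM] := bounded_lt N k.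
  exists M => y xy; apply: kU; apply/bcodeP => m mk.
  by apply: hN; apply: agree_le xy; have := hM m mk; lia.
- by move=> x Cx; exists n => y /nC; apply.
- by move=> x Cx; exists n => y xy Cy; apply: Cx; apply: nC Cy; apply: agree_sym.
Qed.

(** In the finer topologies the rectangle is closed, and closed sets belong to every class [piB]. *)
Lemma pot_piB_rect (I : Type) (Rel : I -> I -> Prop) (i : I) (C C' : set (nat -> nat)) :
  clopenable C -> clopenable C' ->
  @pot_piB (coded (@bcode nat)) (coded (@bcode nat)) I Rel i [set p | C p.1 /\ C' p.2].
Proof.
move=> /clopenable_polish [O [pO fO OC OnC]] /clopenable_polish [O' [pO' fO' OC' OnC']].
have OT : O setT by apply: fO; apply: copenT.
have OT' : O' setT by apply: fO'; apply: copenT.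
exists O, O'; split=> //; apply: sigmaB_open => -[x y] /= /not_andP [nC|nC].
  by exists (~` C), setT; split=> // -[x' y'] /= nC' _ [].
by exists setT, (~` C'); split=> // -[x' y'] /= _ nC' [].
Qed.

Lemma analytic_graph C : clopenable C -> analytic (graph C).
Proof.
move=> cC; apply: (@analytic_image int _ _ (@bcode int) (@bcode int) (fun x _ => x)
  (fun x z => shift (sidon z) x)) => // n; exists n => x z x' z' xx' zz' //.
apply/bcodeP => m mn; rewrite /shift (sidon_lip zz') //.
by move/bcodeP: xx' => ->.
Qed.

Lemma graph_not_pot (I : Type) (Rel : I -> I -> Prop) (i : I) (C : set (nat -> nat)) D :
  ~ sigmaB (copen (@bcode nat)) Rel i (~` C) ->
  pot_piB Rel i D -> graph C `<=` D -> D `&` graph (~` C) = set0 -> False.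
Proof.
move=> nC [O1 [O2 [f1 p1 f2 p2 sD]]] CD DC; apply: nC.
apply: (not_pot_separable (phi := sidon) sidon_lip f1 p1 f2 p2 sD) => x z; split.
  move=> Dxz; apply: contrapT => nC.
  have : (D `&` graph (~` C)) (x, shift (sidon z) x) by split=> //; exists x, z.
  by rewrite DC.
by move=> Cz; apply: CD; exists x, z.
Qed.

Lemma graph_disjoint C : graph C `&` graph (~` C) = set0.
Proof.
apply/seteqP; split=> // _ [[x [z [Cz ->]]] [x' [z' [nC [<- e]]]]]; apply: nC.
suff -> : z' = z by [].
rewrite -(sidonK z) -(sidonK z'); congr unsidon; apply/funext => m.
by have := congr1 (fun f => f m) e; rewrite /shift; lia.
Qed.

Lemma unsidon_continuous (f : (nat -> int) -> nat -> int) :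
  (forall x y m, x m = y m -> f x m = f y m) ->
  continuous (fun x : coded (@bcode int) => unsidon (f x) : coded (@bcode nat)).
Proof.
move=> hf; apply: coded_continuous => x n; exists (n.+1).*2 => y /bcodeP xy.
apply/bcodeP => m mn; rewrite /unsidon (hf x y) //; apply: xy; lia.
Qed.

Lemma analytic_snd C : clopenable C ->
  @analytic (coded (@bcode nat) * coded (@bcode nat))%type [set p | setT p.1 /\ C p.2].
Proof.
move=> cC; have -> : [set p | setT p.1 /\ C p.2] =
    [set p | exists (x z : nat -> nat), C z /\ p = (x, z)].
  apply/seteqP; split=> [[x z] [_ Cz]|_ [x [z [Cz ->]]]]; last by split.
  by exists x, z.
apply: (@analytic_image nat _ _ (@bcode nat) (@bcode nat) (fun x _ => x) (fun _ z => z)) => //.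
  by move=> n; exists n.
by move=> n; exists n => x z x' z' _ zz'; apply/bcodeP.
Qed.

Lemma analytic_fst C : clopenable C ->
  @analytic (coded (@bcode nat) * coded (@bcode nat))%type [set p | C p.1 /\ setT p.2].
Proof.
move=> cC; have -> : [set p | C p.1 /\ setT p.2] =
    [set p | exists (x z : nat -> nat), C z /\ p = (z, x)].
  apply/seteqP; split=> [[z x] [Cz _]|_ [x [z [Cz ->]]]]; last by split.
  by exists x, z.
apply: (@analytic_image nat _ _ (@bcode nat) (@bcode nat) (fun _ z => z) (fun x _ => x)) => //.
  by move=> n; exists n => x z x' z' _ zz'; apply/bcodeP.
by move=> n; exists n.
Qed.

(* xi < omega_1 is the order type of the predecessors of t in the countable
   well-ordered set (I, Rel). *)
Theorem theorem1p13 (I : countType) (Rel : I -> I -> Prop) (t : I) :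
  strict_well_order Rel ->
  ~ exists S : set (cantor_space * cantor_space),
      borel S /\
      forall (X Y : topologicalType), polish X -> polish Y ->
      forall A B : set (X * Y), analytic A -> analytic B -> A `&` B = set0 ->
      let Pa := exists D : set (X * Y), [/\ pot_piB Rel t D, A `<=` D & D `&` B = set0] in
      let Pb := exists (u : cantor_space -> X) (v : cantor_space -> Y),
          [/\ continuous u, continuous v,
              (forall p, S p -> A (u p.1, v p.2)) &
              (forall p, ~ S p -> B (u p.1, v p.2))] in
      (Pa \/ Pb) /\ ~ (Pa /\ Pb).
Proof.
move=> [_ _ _ wf] [S [_ dich]].
have [C [cC nC]] := clopenable_not_sigmaB t wf; have cC' := clopenableC cC.
pose X := coded (@bcode int); pose N := coded (@bcode nat).
have pX : polish X by exact: bcode_polish.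
have pN : polish N by exact: bcode_polish.
case: (dich X X pX pX _ _ (analytic_graph cC) (analytic_graph cC') (graph_disjoint C)).
move=> [[D [pD CD DC]]|[u [v [cu cv uvC uvC']]]] _; first exact: graph_not_pot nC pD CD DC.
(* By (b) every point of the square is sent into one of the two graphs, and the parameter found
   there decides membership in [S]. *)
have /choice [z0 hz0] : forall p : cantor_space * cantor_space, exists z,
    v p.2 = shift (sidon z) (u p.1) /\ (S p <-> C z).
  move=> p; have [/[dup] Sp /uvC|/[dup] nSp /uvC'] := pselect (S p).
    by move=> [x [z [Cz [-> ->]]]]; exists z; split.
  by move=> [x [z [Cz [-> ->]]]]; exists z; split=> //; split.
pose z x y := z0 (x, y).
have hz x y : v y = shift (sidon (z x y)) (u x) by case: (hz0 (x, y)).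
have hS x y : S (x, y) <-> C (z x y) by case: (hz0 (x, y)).
have zE x y : z x y = unsidon (fun m => u x m - v y m)%R.
  rewrite -[LHS]sidonK; congr unsidon; apply/funext => m.
  by rewrite (hz x y) /shift; lia.
pose o : cantor_space := fun _ => false.
have cT : clopenable setT := clopenable_coord 0%N setT.
case: (graph_rectangle hz) => [cstu|cstv].
  (* With [u] constant, [S] depends continuously on [y] alone through [C]; this reduction yields (b)
     for the two cylinders, while (a) holds with the first cylinder as [D]. *)
  have Cf x y : S (x, y) <-> C (unsidon (fun m => u o m - v y m)%R).
    by rewrite hS zE (cstu x o).
  case: (dich N N pN pN _ _ (analytic_snd cC) (analytic_snd cC')).
    by apply/seteqP; split=> // p [[_ Cp] [_ nCp]].
  move=> _; apply; split.
    exists [set p | setT p.1 /\ C p.2]; split=> //; first exact: pot_piB_rect.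
    by apply/seteqP; split=> // p [[_ Cp] [_ nCp]].
  exists (fun _ => (fun _ => 0%N) : N), (fun y => unsidon (fun m => u o m - v y m)%R : N).
  split; first by move=> x; apply: cvg_cst.
  - have cf := @unsidon_continuous (fun k m => u o m - k m)%R
      (fun k k' m e => congr1 (fun c => u o m - c)%R e).
    by move=> y; exact: (continuous_comp (cv y) (cf (v y))).
  - by move=> [x y] /Cf.
  - by move=> [x y] nS; split=> //= Cy; apply: nS; apply/Cf.
(* The symmetric case, with [v] constant and the cylinders over the first coordinate. *)
have Cf x y : S (x, y) <-> C (unsidon (fun m => u x m - v o m)%R).
  by rewrite hS zE (cstv y o).
case: (dich N N pN pN _ _ (analytic_fst cC) (analytic_fst cC')).
  by apply/seteqP; split=> // p [[Cp _] [nCp _]].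
move=> _; apply; split.
  exists [set p | C p.1 /\ setT p.2]; split=> //; first exact: pot_piB_rect.
  by apply/seteqP; split=> // p [[Cp _] [nCp _]].
exists (fun x => unsidon (fun m => u x m - v o m)%R : N), (fun _ => (fun _ => 0%N) : N).
split.
- have cf := @unsidon_continuous (fun k m => k m - v o m)%R
    (fun k k' m e => congr1 (fun c => c - v o m)%R e).
  by move=> x; exact: (continuous_comp (cu x) (cf (u x))).
- by move=> x; apply: cvg_cst.
- by move=> [x y] /Cf.
- by move=> [x y] nS; split=> //= Cx; apply: nS; apply/Cf.
Qed.
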